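(* For each finitely supported sequence $\{\epsilon_\ell\}_{\ell\ge0}\in\Bbbk^{\mathbb Z_{\ge0}}=\bigoplus_{\ell\ge0}\Bbbk$, the formulas $$\eta^0(T_i)=\sum_{\ell=0}^\infty\epsilon_\ell\,s_i^\ell\quad(0\le i\le N),\qquad \eta^1=\eta^2=\eta^3=\cdots=0$$ define a degree $0$ $A_\infty$-natural transformation $\eta_{\{\epsilon_\ell\}}:\mathrm{id}\Rightarrow\mathrm{id}$, and these represent all cohomology classes of degree $0$ natural transformations exactly once: $\{\epsilon_\ell\}\mapsto[\eta_{\{\epsilon_\ell\}}]$ is an isomorphism $\Bbbk^{\mathbb Z_{\ge0}}\cong \mathrm{HH}^0(\Delta)=H^0\operatorname{Hom}(\mathrm{id},\mathrm{id})$.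
   Context: Let $\Bbbk$ be a field, $N\ge1$ (number of punctures). $\mathcal C$ is the $\Bbbk$-linear category (an $A_\infty$-category concentrated in degree $0$ with only $\mu^2$ nonzero) with objects $T_0,\dots,T_N$, where $\operatorname{Hom}(T_i,T_j)$ has $\Bbbk$-basis $\{a_{ji}s^\alpha\}_{\alpha\ge0}$ and composition $a_{kj}s^\beta\cdot a_{ji}s^\alpha=a_{ki}s^{\alpha+\beta+\delta(i,j,k)}$, $\delta(i,j,k)=\frac12(|i-j|+|j-k|-|i-k|)$. Write $s_i^\alpha=a_{ii}s^\alpha$; $s_i^0=e_i$ is the identity of $T_i$. It is the full subcategory on generators of the Fukaya category considered; functors and natural transformations are computed on $\mathcal C$ and extended to $\mathrm{Tw}^b(\mathcal C)$. A degree $g$ pre-natural transformation $\eta:\mathrm{id}\Rightarrow\mathrm{id}$ consists of multilinear maps $\eta^d:\operatorname{Hom}(X_{d-1},X_d)\otimes\cdots\otimes\operatorname{Hom}(X_0,X_1)\to\operatorname{Hom}^{g-d}(X_0,X_d)$, $d\ge0$ ($\eta^0$ being an element of $\operatorname{Hom}^g(X_0,X_0)$ for each object); as $\mathcal C$ is in degree $0$ only $\eta^g$ can be nonzero. The differential is $$\mu^1(\eta)^d(a_d,\dots,a_1)=a_d\cdot\eta^{d-1}(a_{d-1},\dots,a_1)+(-1)^{g-1}\eta^{d-1}(a_d,\dots,a_2)\cdot a_1-\sum_{n=0}^{d-2}(-1)^{n+g-1}\eta^{d-1}(a_d,\dots,a_{n+2}\cdot a_{n+1},\dots,a_1).$$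 $\eta$ is an $A_\infty$-natural transformation if $\mu^1(\eta)=0$. $\mathrm{HH}^g(\Delta)=H^g\operatorname{Hom}(\mathrm{id},\mathrm{id})$ is the degree-$g$ cohomology of this complex (Hochschild cohomology of $\mathcal C$ with coefficients in its diagonal bimodule $\Delta$). *)

(* Defs.v *)
From HB Require Import structures.
From mathcomp Require Import all_boot all_order all_algebra.
From mathcomp Require Import zify ring.
From mathcomp Require Import boolp functions.

Set Implicit Arguments.
Unset Strict Implicit.
Unset Printing Implicit Defensive.

Import Order.TTheory GRing.Theory Num.Theory.
Local Open Scope ring_scope.
Local Open Scope quotient_scope.

(* The quotient {quot I} of an lmodType by a submodule I; MathComp only
   provides its zmodType structure. *)
Section LmodQuotient.
Variables (R : pzRingType) (V : lmodType R).
Variables (I : zmodClosed V) (IZ : GRing.scaler_closed I).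
Local Notation Q := (Quotient.quot I).

Definition lmod_quot of GRing.scaler_closed I : Type := Q.
Local Notation lquot := (lmod_quot IZ).

HB.instance Definition _ := GRing.Zmodule.on lquot.

Definition lmod_quot_scale (a : R) (x : lquot) : lquot :=
  \pi_Q (a *: repr (x : Q)).

Lemma pi_lmod_quot_eq (x y : V) :
  (\pi_Q x = \pi_Q y) <-> (x - y \in I).
Proof. by rewrite Quotient.idealrBE; split => /eqP. Qed.

Lemma pi_lmod_quot_scale a (x : V) :
  lmod_quot_scale a (\pi_Q x) = \pi_Q (a *: x).
Proof.
apply/pi_lmod_quot_eq; rewrite -scalerBr; apply: IZ.
by apply/pi_lmod_quot_eq; rewrite reprK.
Qed.

Lemma lmod_quot_scaleA a b x :
  lmod_quot_scale a (lmod_quot_scale b x) = lmod_quot_scale (a * b) x.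
Proof.
elim/(@quotW _ Q): x => v.
by rewrite !pi_lmod_quot_scale scalerA.
Qed.

Lemma lmod_quot_scale1 : left_id 1 lmod_quot_scale.
Proof.
by move=> x; elim/(@quotW _ Q): x => v; rewrite pi_lmod_quot_scale scale1r.
Qed.

Lemma lmod_quot_scaleDr : right_distributive lmod_quot_scale +%R.
Proof.
move=> a x y; elim/(@quotW _ Q): x => v; elim/(@quotW _ Q): y => w.
rewrite -[_ + _ in LHS](raddfD \pi_Q) !pi_lmod_quot_scale scalerDr.
exact: (raddfD \pi_Q).
Qed.

Lemma lmod_quot_scaleDl x : {morph lmod_quot_scale^~ x : a b / a + b}.
Proof.
move=> a b; elim/(@quotW _ Q): x => v.
rewrite !pi_lmod_quot_scale scalerDl.
exact: (raddfD \pi_Q).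
Qed.

HB.instance Definition _ := GRing.Zmodule_isLmodule.Build R lquot
  lmod_quot_scaleA lmod_quot_scale1 lmod_quot_scaleDr lmod_quot_scaleDl.

Definition lmod_quot_pi (v : V) : lquot := \pi_Q v.

Lemma lmod_quot_pi_is_linear : linear lmod_quot_pi.
Proof.
move=> a u v; rewrite /lmod_quot_pi (raddfD \pi_Q) /=.
by rewrite -pi_lmod_quot_scale.
Qed.

HB.instance Definition _ :=
  GRing.isLinear.Build R V lquot *:%R lmod_quot_pi lmod_quot_pi_is_linear.

End LmodQuotient.

Section Category.
Variables (k : fieldType) (N : nat).

(* The object T_i is the index i. *)
Definition obj := 'I_N.+1.

(* Hom(T_i, T_j) is free on the a_{ji} s^alpha (alpha >= 0); an element is
   encoded by its coefficients, a_{ji} s^alpha being the monomial 'X^alpha.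
   The carrier does not depend on i and j, only the composition does. *)
Definition Hom (i j : obj) : Type := {poly k}.
HB.instance Definition _ i j := GRing.Lmodule.on (Hom i j).

Definition as_ (j i : obj) (alpha : nat) : Hom i j := 'X^alpha.

Definition s_ (i : obj) (alpha : nat) : Hom i i := as_ i i alpha.

(* |i - j|, through truncated subtractions. *)
Definition dist (i j : obj) : nat := ((i - j) + (j - i))%N.

(* The numerator is nonnegative and even, so neither operation truncates. *)
Definition delta (i j l : obj) : nat :=
  ((dist i j + dist j l - dist i l)./2)%N.

Definition hcomp (i j l : obj) (b : Hom j l) (a : Hom i j) : Hom i l :=
  (b : {poly k}) * (a : {poly k}) * 'X^(delta i j l).

Lemma deltaE i j l : (dist i l + (delta i j l).*2 = dist i j + dist j l)%N.
Proof. rewrite /delta /dist; lia. Qed.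

Lemma hcomp_as i j l alpha beta :
  hcomp (as_ l j beta) (as_ j i alpha) = as_ l i (alpha + beta + delta i j l).
Proof. by rewrite /hcomp /as_ -!exprD (addnC alpha). Qed.

Lemma hcomp1m i j (a : Hom i j) : hcomp (s_ j 0) a = a.
Proof.
rewrite /hcomp /s_ /as_; have -> : delta i j j = 0%N by rewrite /delta /dist; lia.
by rewrite !expr0 mul1r mulr1.
Qed.

Lemma hcompm1 i j (a : Hom i j) : hcomp a (s_ i 0) = a.
Proof.
rewrite /hcomp /s_ /as_; have -> : delta i i j = 0%N by rewrite /delta /dist; lia.
by rewrite !expr0 !mulr1.
Qed.

Lemma hcompA i j l m (c : Hom l m) (b : Hom j l) (a : Hom i j) :
  hcomp c (hcomp b a) = hcomp (hcomp c b) a.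
Proof.
rewrite /hcomp.
have E : (delta i j l + delta i l m = delta j l m + delta i j m)%N.
  by move: (deltaE i j l) (deltaE i l m) (deltaE j l m) (deltaE i j m); lia.
have {}E : 'X^(delta i j l) * 'X^(delta i l m)
         = 'X^(delta j l m) * 'X^(delta i j m) :> {poly k}.
  by rewrite -!exprD E.
have -> : (c : {poly k}) * ((b : {poly k}) * (a : {poly k}) * 'X^(delta i j l))
    * 'X^(delta i l m) = (c : {poly k}) * (b : {poly k}) * (a : {poly k})
    * ('X^(delta i j l) * 'X^(delta i l m)) by ring.
rewrite E; ring.
Qed.

(* The morphisms (a_1, ..., a_d) along X_0, ..., X_d: for i : 'I_d, a i is
   a_{i+1} : X_i -> X_{i+1}, and lift ord_max i, lift ord0 i are i and i + 1 as
   elements of 'I_d.+1. *)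
Definition mors (d : nat) (X : 'I_d.+1 -> obj) : Type :=
  forall i : 'I_d, Hom (X (lift ord_max i)) (X (lift ord0 i)).

Record chain := Chain {
  len : nat;
  vertex : 'I_len.+1 -> obj;
  mor : mors vertex
}.

(* All components eta^d at once: eta (Chain X a) is the value
   eta^d(a_d, ..., a_1) at the objects X_0, ..., X_d. *)
Definition cochain : Type :=
  forall s : chain, Hom (vertex (c := s) ord0) (vertex (c := s) ord_max).

HB.instance Definition _ := GRing.Lmodule.copy cochain (chain -> {poly k}).

Definition set_mor d (X : 'I_d.+1 -> obj) (a : mors X) (i : 'I_d)
    (x : Hom (X (lift ord_max i)) (X (lift ord0 i))) : mors X :=
  fun j => if j == i then x else a j.

Definition multilinear d (X : 'I_d.+1 -> obj) (Y : lmodType k)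
    (f : mors X -> Y) : Prop :=
  forall (a : mors X) (i : 'I_d), linear (fun x => f (set_mor a (i := i) x)).

(* Membership in Hom^m, which is the whole Hom for m = 0 and 0 otherwise. *)
Definition has_degree (m : int) i j (f : Hom i j) : Prop := m != 0 -> f = 0.

(* eta is a degree g pre-natural transformation id => id. *)
Definition prenat (g : int) (eta : cochain) : Prop :=
  forall d (X : 'I_d.+1 -> obj),
    multilinear (fun a : mors X => eta (Chain a)) /\
    forall a : mors X, has_degree (g - d%:Z) (eta (Chain a)).

(* (a_d, ..., a_2) along X_1, ..., X_d, for a chain of length d = e.+1. *)
Definition drop_first e (X : 'I_e.+2 -> obj) (a : mors X) : chain :=
  @Chain e (fun i => X (lift ord0 i)) (fun i => a (lift ord0 i)).

(* (a_{d-1}, ..., a_1) along X_0, ..., X_{d-1}. *)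
Definition drop_last e (X : 'I_e.+2 -> obj) (a : mors X) : chain :=
  @Chain e (fun i => X (lift ord_max i)) (fun i => a (lift ord_max i)).

(* (a_d, ..., a_{n+2} . a_{n+1}, ..., a_1) along X_0, ..., X_d with X_{n+1}
   omitted. *)
Definition contract e (X : 'I_e.+2 -> obj) (a : mors X) (n : 'I_e) : chain :=
  @Chain e (fun i => X (lift (inord n.+1) i))
    (fun i : 'I_e =>
       if (i < n)%N then a (lift ord_max i)
       else if i == n then
         hcomp (i := X (inord n)) (j := X (inord n.+1)) (l := X (inord n.+2))
           (a (lift ord0 n)) (a (lift ord_max n))
       else a (lift ord0 i)).

(* The differential on degree g pre-natural transformations.  Since eta^{-1}
   does not exist, mu1(eta)^0 = 0. *)
Definition mu1 (g : int) (eta : cochain) : cochain := fun s =>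
  match s return {poly k} with
  | @Chain 0 _ _ => 0
  | @Chain e.+1 X a =>
      hcomp (i := X ord0) (j := X (lift ord_max ord_max)) (l := X ord_max)
        (a ord_max) (eta (drop_last a))
      + ((-1) ^ (g - 1)) *:
        hcomp (i := X ord0) (j := X (lift ord0 ord0)) (l := X ord_max)
          (eta (drop_first a)) (a ord0)
      - \sum_(n < e)
          ((-1) ^ (n%:Z + g - 1)) *: (eta (contract a n) : {poly k})
  end.

Definition nat_transf (g : int) (eta : cochain) : Prop :=
  prenat g eta /\ mu1 g eta = 0.

Definition coboundary (g : int) (eta : cochain) : Prop :=
  exists2 xi : cochain, prenat (g - 1) xi & mu1 (g - 1) xi = eta.

Lemma hcompDl i j l (b c : {poly k}) (a : Hom i j) :
  hcomp (b + c : Hom j l) a = (hcomp (b : Hom j l) a + hcomp (c : Hom j l) a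
    : {poly k}).
Proof. by rewrite /hcomp !mulrDl. Qed.

Lemma hcompZl i j l x (b : {poly k}) (a : Hom i j) :
  hcomp (x *: b : Hom j l) a = (x *: (hcomp (b : Hom j l) a : {poly k})
    : {poly k}).
Proof. by rewrite /hcomp !scalerAl. Qed.

Lemma hcompDr i j l (b : Hom j l) (a c : {poly k}) :
  hcomp b (a + c : Hom i j) = (hcomp b (a : Hom i j) + hcomp b (c : Hom i j)
    : {poly k}).
Proof. by rewrite /hcomp mulrDr mulrDl. Qed.

Lemma hcompZr i j l x (b : Hom j l) (a : {poly k}) :
  hcomp b (x *: a : Hom i j) = (x *: (hcomp b (a : Hom i j) : {poly k})
    : {poly k}).
Proof. by rewrite /hcomp [RHS]scalerAl scalerAr. Qed.

Lemma cochainP (eta xi : cochain) : (forall s, eta s = xi s) -> eta = xi.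
Proof. exact: (@functional_extensionality_dep _ _ eta xi). Qed.

Lemma cochainE x (eta xi : cochain) s :
  (x *: eta + xi) s = (x *: (eta s : {poly k}) + xi s : {poly k}).
Proof. by []. Qed.

Lemma mu1_is_linear g : linear (mu1 g).
Proof.
move=> x eta xi; apply: cochainP => s; rewrite cochainE.
case: s => -[|e] X a; rewrite /mu1; first by rewrite scaler0 addr0.
rewrite !cochainE hcompDr hcompZr hcompDl hcompZl.
under eq_bigr => n _ do rewrite cochainE scalerDr scalerA mulrC -scalerA.
rewrite big_split /= -scaler_sumr.
rewrite scalerBr !scalerDr !scalerA (mulrC _ x) opprD.
by rewrite [LHS](AC ((2*2)*2) ((1*3*5)*(2*4*6))).
Qed.

HB.instance Definition _ g :=
  GRing.isLinear.Build k cochain cochain *:%R (mu1 g) (mu1_is_linear g).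

Lemma prenat_submod g : prenat g 0 /\
  forall x eta xi, prenat g eta -> prenat g xi -> prenat g (x *: eta + xi).
Proof.
split=> [|x eta xi etaP xiP] d X; [split=> [a i y u v|a]|].
- by rewrite scaler0 addr0.
- by [].
have [etaM etaD] := etaP d X; have [xiM xiD] := xiP d X.
split=> [a i y u v|a gd]; last by rewrite cochainE etaD // xiD // scaler0 addr0.
rewrite !cochainE etaM xiM !scalerDr !scalerA (mulrC x).
by rewrite [LHS](AC (2*2) ((1*3)*(2*4))).
Qed.

Definition nat_transf_pred (g : int) : {pred cochain} :=
  fun eta => `[< nat_transf g eta >].

Lemma nat_transf_submod g : submod_closed (nat_transf_pred g).
Proof.
have [p0 pD] := prenat_submod g; split=> [|x eta xi].
  by apply/asboolP; split; rewrite ?raddf0.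
move=> /asboolP[etaP eta0] /asboolP[xiP xi0]; apply/asboolP.
by split; [exact: pD | rewrite mu1_is_linear eta0 xi0 scaler0 addr0].
Qed.

HB.instance Definition _ g :=
  GRing.isSubmodClosed.Build k cochain (nat_transf_pred g) (nat_transf_submod g).

(* The k-vector space of degree g A_infinity-natural transformations. *)
Record ainf_nat (g : int) := AinfNat {
  ainf_cochain : cochain;
  ainf_cochainP : ainf_cochain \in nat_transf_pred g
}.

HB.instance Definition _ g := [isSub for @ainf_cochain g].
HB.instance Definition _ g := [Choice of ainf_nat g by <:].
HB.instance Definition _ g := [SubChoice_isSubLmodule of ainf_nat g by <:].

Definition mk_ainf_nat g (eta : cochain) (etaP : nat_transf g eta) :
  ainf_nat g := AinfNat (asboolT etaP).

(* Only cocycles are quotiented, so mu1 (mu1 xi) = 0 is not needed to define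
   HH. *)
Definition coboundary_pred (g : int) : {pred ainf_nat g} :=
  fun z => `[< coboundary g (ainf_cochain z) >].

Arguments coboundary_pred : clear implicits.

Lemma coboundary_submod g : submod_closed (coboundary_pred g).
Proof.
have [p0 pD] := prenat_submod (g - 1); split=> [|x y z].
  by apply/asboolP; exists 0; rewrite ?raddf0.
move=> /asboolP[eta etaP etaE] /asboolP[xi xiP xiE]; apply/asboolP.
exists (x *: eta + xi); first exact: pD.
by rewrite mu1_is_linear etaE xiE.
Qed.

HB.instance Definition _ g :=
  GRing.isSubmodClosed.Build k (ainf_nat g) (coboundary_pred g)
    (coboundary_submod g).

Lemma coboundary_scaler g : GRing.scaler_closed (coboundary_pred g).
Proof. exact: (GRing.submod_closed_semi (coboundary_submod g)).2. Qed.

Definition HH (g : int) := lmod_quot (@coboundary_scaler g).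

HB.instance Definition _ g := GRing.Lmodule.on (HH g).

Definition HH_class g (z : ainf_nat g) : HH g := lmod_quot_pi _ z.

(* eta_{eps}.  A finitely supported sequence (eps_l) is an element of
   {poly k}, that is, a list without trailing zeros, with eps_l = eps`_l. *)
Definition eta_ (eps : {poly k}) : cochain := fun s =>
  match s return {poly k} with
  | @Chain 0 X _ => \sum_(l < size eps) eps`_l *: (s_ (X ord0) l : {poly k})
  | @Chain _.+1 _ _ => 0
  end.

End Category.

(* Main.v *)
Require Import Defs.
From mathcomp Require Import all_boot all_order all_algebra.
From mathcomp Require Import boolp zify.

Import GRing.Theory.
Local Open Scope ring_scope.

(** All morphisms sit in degree 0, so a pre-natural transformation of degree
    [g] vanishes off chains of length exactly [g].  Two consequences drive the
    proof.
    - In degree -1 there is nothing at all ([prenat_neg_eq0]), hence no nonzero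
      coboundary in degree 0 ([coboundary0_eq0]): classes are cocycles.
    - A degree 0 cochain is a family of endomorphisms [f_i] of the objects
      [T_i], and its differential on a morphism [a : T_i -> T_j] is
      [a . f_i - f_j . a].  Since [Hom(T_i, T_j)] is a copy of [k[s]] in which
      composing with an endomorphism of either end is plain multiplication of
      polynomials (the shift [delta] vanishes when two consecutive objects
      agree), taking [a = a_{ji}] gives [f_i = f_j], whereas a
      constant family [f_i = eps] commutes with everything because [k[s]] is
      commutative.
    So the degree 0 cocycles are exactly the [eta_ eps] ([nat_transf_eta_] and
    [nat_transf0_eta_]), and [eps] is recovered as the value of [eta_ eps] at
    any object ([eta_point]). *)

Section DegreeZero.
Context {k : fieldType} {N : nat}.
Implicit Types (i j l : obj N) (eps : {poly k}) (eta : cochain k N).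

Lemma hcomp_endor {i j l} (b : Defs.Hom k j l) (a : Defs.Hom k i j) :
  i = j -> hcomp b a = (b : {poly k}) * (a : {poly k}).
Proof.
move=> E; subst j; rewrite /hcomp.
have -> : delta i i l = 0%N by rewrite /delta /dist; lia.
by rewrite expr0 mulr1.
Qed.

Lemma hcomp_endol {i j l} (b : Defs.Hom k j l) (a : Defs.Hom k i j) :
  j = l -> hcomp b a = (b : {poly k}) * (a : {poly k}).
Proof.
move=> E; subst l; rewrite /hcomp.
have -> : delta i j j = 0%N by rewrite /delta /dist; lia.
by rewrite expr0 mulr1.
Qed.

Definition point i : chain k N := @Chain k N 0 (fun=> i) (fun=> 0).

(** Chains carry functions on ['I_1] and ['I_0], so that a chain of length 0
    is determined by its object only up to extensionality. *)
Lemma chain0E (X : 'I_1 -> obj N) (a : mors k X) : Chain a = point (X ord0).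
Proof.
have E : X = fun=> X ord0 by apply: funext => t; rewrite (ord1 t).
move: (X ord0) E => i E; subst X; congr Chain.
by apply: functional_extensionality_dep => -[].
Qed.

Lemma eta_point eps i : eta_ (N:=N) eps (point i) = eps.
Proof.
by rewrite /eta_ /point /= -[RHS]coefK poly_def.
Qed.

(** The differential of a degree 0 cochain on a single morphism is its
    commutator with it: the sign is [(-1)^(0 - 1) = -1] and there is nothing to
    contract. *)
Lemma mu1_chain1 eta (X : 'I_2 -> obj N) (a : mors k X) :
  mu1 0 eta (Chain a) =
  (a ord0 : {poly k})
    * ((eta (point (X ord0)) : {poly k}) - (eta (point (X ord_max)) : {poly k})).
Proof.
have l0 : lift (@ord_max 1) ord0 = ord0 by apply: val_inj.
have l1 : lift (@ord0 1) ord0 = ord_max by apply: val_inj.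
rewrite /mu1 big_ord0 subr0 /drop_last /drop_first !chain0E.
rewrite hcomp_endor; last by congr X; apply: val_inj.
rewrite hcomp_endol; last by congr X; apply: val_inj.
rewrite sub0r exprN1 invrN1 scaleN1r l0 l1 (ord1 ord_max) mulrBr.
by congr (_ - _); rewrite mulrC.
Qed.

Lemma prenat0_pos_eq0 eta d (X : 'I_d.+2 -> obj N) (a : mors k X) :
  prenat 0 eta -> eta (Chain a) = 0.
Proof. by move=> /(_ _ X)[_ /(_ a)]; apply. Qed.

Lemma prenat_neg_eq0 eta : prenat (0 - 1) eta -> eta = 0.
Proof.
move=> etaP; apply: cochainP => -[d X a].
by have [_ /(_ a)] := etaP d X; apply; lia.
Qed.

Lemma coboundary0_eq0 eta : coboundary 0 eta -> eta = 0.
Proof. by case=> xi /prenat_neg_eq0 -> <-; rewrite raddf0. Qed.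

Lemma nat_transf_eta_ eps : nat_transf 0 (@eta_ k N eps).
Proof.
split=> [[|d] X|].
- by split=> [a []|a].
- by split=> [a i x u v|a _] /=; rewrite ?scaler0 ?addr0.
apply: cochainP => -[[//|[|e]] X a].
  by rewrite mu1_chain1 !eta_point subrr mulr0.
rewrite /mu1 /= /hcomp !(mulr0, mul0r) scaler0 addr0 big1 ?subr0 // => n _.
by rewrite scaler0.
Qed.

Lemma nat_transf0_eta_ eta :
  nat_transf 0 eta -> eta = eta_ (eta (point ord0)).
Proof.
case=> etaP eta0; apply: cochainP => -[[|d] X a]; last first.
  by rewrite prenat0_pos_eq0.
rewrite chain0E eta_point; move: (X ord0) => j.
pose Y (t : 'I_2) : obj N := if t == ord0 then j else ord0.
(* The unit polynomial encodes the generator a_{0j} : T_j -> T_0. *)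
pose b : mors k Y := fun=> 1 : {poly k}.
have := mu1_chain1 eta Y b; rewrite eta0 mul1r => /esym/eqP.
by rewrite subr_eq0 => /eqP.
Qed.

Lemma eta_is_linear : linear (@eta_ k N : {poly k} -> cochain k N).
Proof.
move=> x p q; apply: cochainP => -[[|d] X a]; rewrite cochainE.
  by rewrite chain0E !eta_point.
by rewrite /= scaler0 addr0.
Qed.

Lemma HH_class0_inj : injective (@HH_class k N 0).
Proof.
move=> z w /pi_lmod_quot_eq/asboolP/coboundary0_eq0 zw.
by apply/eqP; rewrite -subr_eq0; apply/eqP/val_inj.
Qed.

End DegreeZero.

Theorem theorem9p1 (k : fieldType) (N : nat) (hN : (1 <= N)%N) :
  exists h : forall eps : {poly k}, nat_transf 0 (@eta_ k N eps),
    let Phi (eps : {poly k}) : HH k N 0 := HH_class (mk_ainf_nat (h eps)) in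
    linear Phi /\ bijective Phi.
Proof.
exists nat_transf_eta_ => Phi; split=> [x p q|].
  rewrite /Phi /HH_class -linearP; congr lmod_quot_pi.
  exact/val_inj/eta_is_linear.
pose rep (c : HH k N 0) : ainf_nat k N 0 :=
  repr (c : Quotient.quot (@coboundary_pred k N 0)).
have repK c : HH_class (rep c) = c by exact: reprK.
exists (fun c => ainf_cochain (rep c) (point ord0)) => [eps|c].
  rewrite (HH_class0_inj _ _ (repK (Phi eps))); exact: eta_point.
rewrite -[RHS]repK; congr HH_class; apply: val_inj => /=.
by have /asboolP/nat_transf0_eta_ := ainf_cochainP (rep c).
Qed.
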